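(* Let $X$ be an rr-good Tychonoff space which is not compact. Suppose there are an infinite family $\{U_\alpha\}_{\alpha\in A}$ of pairwise disjoint non-empty cozero sets of $X$ and, for each $\alpha\in A$, a function $f_\alpha\in \mathrm{C}(X)$ such that $\operatorname{coz} f_\alpha=U_\alpha$, $0\le f_\alpha(x)\le 1$ for all $x\in X$, and $f_\alpha(k_\alpha)=1$ for some $k_\alpha\in U_\alpha$. Assume that these data also satisfy: (i) for $\alpha\neq\beta$, $(\mathrm{Fr}_X U_\beta)\cap U_\alpha=\emptyset$; (ii) $K_\alpha=\mathrm{cl}_X U_\alpha$ is compact for all $\alpha\in A$; (iii) the function $f$ defined by $f(x)=f_\alpha(x)$ for $x\in U_\alpha$ and $f(x)=0$ if $x\notin U=\bigcup_{\alpha\in A} U_\alpha$ is continuous on $X$; (iv) $K=f^{-1}(\{1\})$ is not compact in $X$. Then the Stone–Čech compactification $\beta X$ is rr-good and does not have the B-property. Moreover, $\beta X$ is not locally connected.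
   Context: All topological spaces are assumed to be Tychonoff. For a space $X$, $\mathrm{C}(X)$ is the ring of continuous real-valued functions on $X$; for $f\in \mathrm{C}(X)$, $\operatorname{coz} f=\{x\in X: f(x)\neq 0\}$ and a cozero set is a set of this form. $\mathrm{C}(X)$ is partially ordered by the reduced ring order: $f\le_{\mathrm{rr}} g$ if and only if $f^2=fg$. The space $X$ is called rr-good if every pair $f,g\in \mathrm{C}(X)$ has an infimum (greatest lower bound) in $\le_{\mathrm{rr}}$. $\mathrm{Fr}_X U$ (or $\mathrm{Fr}\,U$) denotes the boundary (frontier) of $U$ in $X$ and $\mathrm{cl}_X$ denotes closure in $X$. B-property: a space $X$ satisfies the B-property if for every family $\{U_\alpha\}_{\alpha\in A}$ of non-empty cozero sets in $X$ such that $(\mathrm{Fr}\,U_\alpha)\cap U_\beta=\emptyset$ for all $\alpha\neq\beta$ in $A$, the following holds: for every $z\in \mathrm{Fr}\bigl(\bigcup_{\alpha\in A}U_\alpha\bigr)$ and every neighbourhood $N$ of $z$ there is $\beta\in A$ such that $N\cap \mathrm{Fr}\,U_\beta\neq\emptyset$. *)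

(* Defs.v *)
From HB Require Import structures.
From mathcomp Require Import all_boot all_order all_algebra.
From mathcomp Require Import all_classical all_reals all_analysis.

Set Implicit Arguments.
Unset Strict Implicit.
Unset Printing Implicit Defensive.

Import Order.TTheory GRing.Theory Num.Theory.
Import numFieldNormedType.Exports.

Local Open Scope classical_set_scope.
Local Open Scope ring_scope.

(* [completely_regular_space] asks for separation by a uniformity, which
   [uniform_separatorP] translates into separation by a continuous function
   into [0, 1]. *)
Definition tychonoff_space (X : topologicalType) : Prop :=
  hausdorff_space X /\ completely_regular_space X.

Definition frontier (X : topologicalType) (A : set X) : set X :=
  closure A `&` closure (~` A).

Definition locally_connected (X : topologicalType) : Prop :=
  forall (x : X) (N : set X), nbhs x N ->
    exists V : set X, [/\ open V, V x, connected V & V `<=` N].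

Section rings_of_continuous_functions.
Variables (R : realType) (X : topologicalType).

(* [continuousType X R] plays the role of the ring C(X). *)

Definition coz (f : continuousType X R) : set X := [set x | f x != 0].

Definition cozero_set (U : set X) : Prop :=
  exists f : continuousType X R, U = coz f.

Definition le_rr (f g : continuousType X R) : Prop :=
  forall x, f x ^+ 2 = f x * g x.

Definition is_inf_rr (f g h : continuousType X R) : Prop :=
  [/\ le_rr h f, le_rr h g &
      forall k : continuousType X R, le_rr k f -> le_rr k g -> le_rr k h].

Definition rr_good : Prop :=
  forall f g : continuousType X R, exists h, is_inf_rr f g h.

Definition B_property : Prop :=
  forall (A : Type) (U : A -> set X),
    (forall a, cozero_set (U a)) ->
    (forall a, U a !=set0) ->
    (forall a b, a <> b -> frontier (U a) `&` U b = set0) ->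
    forall (z : X) (N : set X), frontier (\bigcup_a U a) z -> nbhs z N ->
      exists b, N `&` frontier (U b) !=set0.

End rings_of_continuous_functions.

(* The Stone-Cech compactification is the closure of the image of X under the
   evaluation map x |-> (f x)_f, where f ranges over the continuous functions
   from X to [0, 1].  The product is taken over copies of R instead of [0, 1];
   since [0, 1]^J is closed in R^J, the closure is the same. *)
Section stone_cech.
Variables (R : realType) (X : topologicalType).

Definition unit_functions : set (continuousType X R) :=
  [set f | forall x, 0 <= f x <= 1].

Definition stone_cech_eval : X -> {ptws unit_functions -> R} :=
  join_product (fun f : unit_functions => set_val f : X -> R).

Definition stone_cech : topologicalType :=
  set_type (closure (range stone_cech_eval)).

Lemma stone_cech_eval_closure x :
  stone_cech_eval x \in closure (range stone_cech_eval).
Proof. by rewrite inE; apply: subset_closure; exists x. Qed.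

Definition stone_cech_embed (x : X) : stone_cech :=
  exist _ (stone_cech_eval x) (stone_cech_eval_closure x).

End stone_cech.

(* The defining properties of the Stone-Cech compactification: a compact
   Hausdorff space in which X is densely embedded and to which the functions
   from X to [0, 1] extend. *)
Section stone_cech_theory.
Variables (R : realType) (X : topologicalType).
Local Notation bX := (stone_cech R X).
Local Notation e := (@stone_cech_embed R X).
Local Notation J := (@unit_functions R X).

Let proj_cts (j : J) : continuous (fun p : {ptws J -> R} => p j).
Proof. exact: (@proj_continuous J (fun=> R) j). Qed.

Let val_cts : continuous (set_val : bX -> {ptws J -> R}).
Proof. exact: initial_continuous. Qed.

Let val_proj_cts (j : J) :
  continuous (fun p : bX => (set_val p : {ptws J -> R}) j).
Proof.
by move=> p; exact: (cvg_comp _ _ (@val_cts p) (@proj_cts j (set_val p))).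
Qed.

Lemma stone_cech_hausdorff : hausdorff_space bX.
Proof.
move=> p q pq; apply/val_inj/functional_extensionality_dep => j.
apply: (@Rhausdorff R) => A B nA nB.
have [r [Ar Br]] := pq _ _ (@val_proj_cts j p _ nA) (@val_proj_cts j q _ nB).
by exists ((set_val r : {ptws J -> R}) j).
Qed.

Lemma stone_cech_compact : compact [set: bX].
Proof.
pose C : set {ptws J -> R} := [set p | forall j, `[0, 1]%classic (p j)].
have cC : compact C.
  apply: (@tychonoff J (fun=> R) (fun=> `[0, 1]%classic)) => j.
  exact: segment_compact.
have clC : closed C.
  have -> : C = \bigcap_(j in [set: J])
      ((fun p : {ptws J -> R} => p j) @^-1` `[0, 1]%classic).
    apply/seteqP; split=> p /= Cp; first by move=> j _; exact: Cp.
    by move=> j; exact: (Cp j).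
  apply: closed_bigI => j _; apply: preimage_closed; last exact: interval_closed.
  by move=> p _; exact: proj_cts.
have cE : compact (closure (range (@stone_cech_eval R X))).
  apply: (subclosed_compact _ cC); first exact: closed_closure.
  rewrite [X in _ `<=` X](closure_id C).1//; apply: closureS => _ [x _ <-] j /=.
  by rewrite in_itv /=; have := set_valP j; apply.
move=> F FF _; pose v : bX -> {ptws J -> R} := set_val.
have [|q [cq Fq]] := cE (v @ F) (fmap_proper_filter v FF).
  by rewrite /= nbhs_simpl; apply: filterS filterT => p _; exact: set_valP.
exists (exist _ q (mem_set cq) : bX); split => // A B FA [_ [[D oD <-] Dq] DB].
have [|_ [[p Ap <-] Dp]] := Fq (v @` A) D _ (open_nbhs_nbhs (conj oD Dq)).
  by rewrite /= nbhs_simpl; apply: filterS FA => p Ap; exists p.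
by exists p; split => //; exact: DB.
Qed.

Lemma stone_cech_dense : dense (range e).
Proof.
move=> O [p Op] [D oD DO]; have /= clp := set_valP p.
have [|q [[x _ <-] Dq]] := clp D.
  by apply: open_nbhs_nbhs; split => //; rewrite -DO in Op.
by exists (e x); split; [rewrite -DO | exists x].
Qed.

Lemma stone_cech_extension (f : continuousType X R) :
  (forall x, 0 <= f x <= 1) ->
  exists g : continuousType bX R, forall x, g (e x) = f x.
Proof.
move=> f01; pose j : J := exist _ f (mem_set f01).
by exists (mkcts (@val_proj_cts j)).
Qed.

Hypothesis X_tychonoff : tychonoff_space X.

Let eval_sep :
  separate_points_from_closed (fun f : J => set_val f : X -> R).
Proof.
move=> B x clB nBx; have /uniform_separatorP := X_tychonoff.2 x B clB nBx.
move=> /(_ R)[f [cf f01 f0 f1]].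
have J01 : J (mkcts cf).
  by move=> y; have := f01 (f y); rewrite /= in_itv; apply; exists y.
pose j : J := exist _ (mkcts cf : continuousType X R) (mem_set J01).
exists j; have -> : [set (set_val j : X -> R) y | y in B] = f @` B by [].
have fx0 : f x = 0 by apply: f0; exists x.
move=> clfx; have : closed [set 1 : R] by exact: closed_eq.
move=> /(_ _ (closureS f1 clfx)) /=; rewrite -[LHS]/(f x) fx0.
by move/esym/eqP; rewrite oner_eq0.
Qed.

Let set_cts (j : J) : continuous (set_val j : X -> R).
Proof. exact: cts_fun. Qed.

Lemma stone_cech_embed_inj : injective e.
Proof.
move=> x y /(congr1 (set_val : bX -> {ptws J -> R})) xy.
apply: (join_product_inj eval_sep (hausdorff_accessible X_tychonoff.1)) => //;
  exact: in_setT.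
Qed.

Lemma stone_cech_embed_open : @open X = @open (initial_topology e).
Proof.
rewrite (join_product_initial eval_sep set_cts); last first.
  exact: (join_product_inj eval_sep (hausdorff_accessible X_tychonoff.1)).
apply/seteqP; split=> O.
  by move=> [D oD <-]; exists (set_val @^-1` D) => //; exists D.
by move=> [_ [D oD <-] <-]; exists D.
Qed.

End stone_cech_theory.

(* Main.v *)
Require Import Defs.
From HB Require Import structures.
From mathcomp Require Import all_boot all_order all_algebra.
From mathcomp Require Import all_classical all_reals all_analysis.
From mathcomp Require Import ring lra.

Import Order.TTheory GRing.Theory Num.Theory.
Import numFieldNormedType.Exports.

Local Open Scope classical_set_scope.
Local Open Scope ring_scope.

(** Write e : X -> bX for the embedding into the Stone-Cech compactification.

    bX is rr-good because infima are computed on X: restrict f and g to X and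
    take an infimum h there.  From h <=rr f it follows that h only takes the
    values 0 and f x, hence is bounded and extends to bX; both h <=rr f and
    the maximality of h are pointwise equations, which pass from the dense set
    X to bX ([rr_good_stone_cech]).

    The other two claims come from one point z of the remainder.  A cozero set
    of X with compact closure K does not grow in bX: the extension of its
    function vanishes on X outside K, hence, e(K) being closed, everywhere
    outside e(K).  So the sets V_a = e(U_a) are cozero sets of bX, with no new
    boundary points ([coz_extension], [frontier_coz_extension]).  Let F be the
    extension of f.  As f^-1(1) is closed but not compact, its closure in bX
    contains a point z outside e(X) ([compact_of_closure_embed]).  Then
    F z = 1, and z is a limit of the union of the V_a without belonging to any
    of them.  But f vanishes on every Fr U_a, so N = {F > 1/2} is a
    neighbourhood of z that misses every Fr V_a, against the B-property.  For
    the same reason a connected neighbourhood of z inside N, which must meet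
    some V_a, meets it in a clopen subset and so lies in V_a; this is absurd as
    z is not in V_a. *)

(** * Open sets, dense sets and continuous real functions *)

Lemma frontier_open {X : topologicalType} (U : set X) :
  open U -> frontier U = closure U `\` U.
Proof.
move=> oU; rewrite /frontier -(closure_id (~` U)).1 ?setDE//.
exact: open_closedC.
Qed.

Lemma open_coz {R : realType} {X : topologicalType} (f : continuousType X R) :
  open (coz f).
Proof.
apply: (@open_comp _ _ f [set y | y != 0]); last exact: open_neq.
by move=> x _; exact: cts_fun.
Qed.

(** The form in which all density arguments below are run: a closed condition
    only has to be checked on a dense subset. *)
Lemma closed_dense_sub {X : topologicalType} (D C : set X) :
  dense D -> closed C -> D `<=` C -> forall p, C p.
Proof.
move=> dD cC DC p; apply: contrapT => nCp.
have [|q [nCq /DC//]] := dD (~` C) _ (closed_openC cC).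
by exists p.
Qed.

Section real_continuous_functions.
Context {R : realType} {Y : topologicalType}.
Implicit Types f g : continuousType Y R.

Lemma continuous_mul_fun f g : continuous (fun x => f x * g x : R).
Proof. by move=> x; apply: cvgM; exact: cts_fun. Qed.

Lemma continuous_affine (a b : R) f : continuous (fun x => a * f x + b : R).
Proof.
move=> x; apply: cvgD; last exact: cvg_cst.
by apply: cvgM; [exact: cvg_cst | exact: cts_fun].
Qed.

Lemma continuous_dense_eq (D : set Y) f g :
  dense D -> {in D, f =1 g} -> f =1 g.
Proof.
move=> dD fg p; apply/eqP; rewrite -subr_eq0; apply/eqP; move: p.
apply: (@closed_dense_sub _ _ [set p | f p - g p = 0] dD).
- apply: (@preimage_closed _ _ (fun p => f p - g p)) (@closed_eq R 0) => p _.
  by apply: cvgB; exact: cts_fun.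
- by move=> x Dx /=; rewrite fg ?subrr// inE.
Qed.

Lemma open_superlevel f (c : R) : open [set x | c < f x].
Proof.
apply: (@open_comp _ _ f [set y | c < y]); last exact: open_gt.
by move=> x _; exact: cts_fun.
Qed.

Lemma compact_bounded_fun f :
  compact [set: Y] -> exists M, forall x, `|f x| <= M.
Proof.
move=> cY; have cf : {within [set: Y], continuous f}.
  by apply: continuous_subspaceT => p; exact: cts_fun.
have /compact_bounded[M [_ fM]] := continuous_compact cf cY.
by exists (M + 1) => p; apply: (fM (M + 1)); [rewrite ltrDl | exists p].
Qed.

End real_continuous_functions.

(** * Extension to the Stone-Cech compactification *)

Section stone_cech_facts.
Context {R : realType} {X : topologicalType}.
Local Notation bX := (stone_cech R X).
Local Notation e := (@stone_cech_embed R X).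

Lemma stone_cech_eq (f g : continuousType bX R) :
  (forall x, f (e x) = g (e x)) -> f =1 g.
Proof.
move=> fg; apply: continuous_dense_eq (@stone_cech_dense R X) _ => p.
by rewrite inE => -[x _ <-].
Qed.

(** An affine map carries [-N, N] onto [0, 1], which reduces bounded functions
    to the case of [stone_cech_extension]. *)
Lemma stone_cech_extension_bounded {f : continuousType X R} {M : R} :
  (forall x, `|f x| <= M) ->
  exists g : continuousType bX R, forall x, g (e x) = f x.
Proof.
(* The 1 keeps N positive, so that the affine map is invertible. *)
move=> fM; pose N : R := `|M| + 1.
have N0 : 0 < N by rewrite ltr_wpDl.
have fN x : `|f x| <= N.
  by rewrite (le_trans (fM x))// (le_trans (ler_norm _))// lerDl.
have [x|g gE] := @stone_cech_extension R X
  (mkcts (continuous_affine (2 * N)^-1 2^-1 f)).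
  change (0 <= (2 * N)^-1 * f x + 2^-1 <= 1).
  have := fN x; rewrite ler_norml => /andP[f1 f2].
  have -> : (2 * N)^-1 * f x + 2^-1 = (f x + N) / (2 * N).
    by field; rewrite gt_eqF.
  by rewrite ler_pdivlMr ?ler_pdivrMr ?mulr_gt0//; lra.
exists (mkcts (continuous_affine (2 * N) (- N) g)) => x.
have gx : g (e x) = (2 * N)^-1 * f x + 2^-1 := gE x.
rewrite -[LHS]/(2 * N * g (e x) - N) gx.
by field; rewrite gt_eqF.
Qed.

Hypothesis X_tychonoff : tychonoff_space X.

Lemma stone_cech_embed_continuous : continuous e.
Proof.
apply/continuousP => O oO; rewrite (stone_cech_embed_open R X_tychonoff).
by exists O.
Qed.

(** The infimum on X of the restrictions extends to bX and is an infimum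
    there, since h <=rr f is a pointwise equation between continuous
    functions. *)
Lemma rr_good_stone_cech : rr_good R X -> rr_good R bX.
Proof.
move=> Xgood f g.
have cr (k : continuousType bX R) : continuous (k \o e).
  by move=> x; apply: continuous_comp;
    [exact: stone_cech_embed_continuous | exact: cts_fun].
pose res k : continuousType X R := mkcts (cr k).
have [h [hf hg hmax]] := Xgood (res f) (res g).
have [M fM] := compact_bounded_fun f (@stone_cech_compact R X).
(* From h <=rr f: at each point h is 0 or agrees with f, which is bounded. *)
have hM x : `|h x| <= M.
  apply: le_trans (fM (e x)); have /eqP := hf x.
  rewrite /mkcts /= expr2 -subr_eq0 -mulrBr mulf_eq0 subr_eq0.
  by move=> /orP[] /eqP ->; rewrite ?normr0.
have [H HE] := stone_cech_extension_bounded hM.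
have le_ext (k l : continuousType bX R) :
    (forall x, k (e x) ^+ 2 = k (e x) * l (e x)) -> le_rr k l.
  move=> kl p; rewrite expr2.
  apply: (@stone_cech_eq (mkcts (continuous_mul_fun k k))
                         (mkcts (continuous_mul_fun k l))) => x.
  exact: kl.
exists H; split.
- by apply: le_ext => x; rewrite HE; exact: hf.
- by apply: le_ext => x; rewrite HE; exact: hg.
- move=> k kf kg; apply: le_ext => x; rewrite HE.
  by apply: (hmax (res k)) => y; [exact: kf | exact: kg].
Qed.

Lemma compact_stone_cech_embed (K : set X) :
  compact K -> compact (e @` K).
Proof.
apply: continuous_compact; apply: continuous_subspaceT.
exact: stone_cech_embed_continuous.
Qed.

(** In bX the closure of e(K) is compact.  If it has no points in the
    remainder, it gives every filter on K a cluster point in X, because e is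
    an embedding, and this point lies in K because K is closed.  It is used
    in contrapositive form, to find points of the remainder. *)
Lemma compact_of_closure_embed (K : set X) :
  closed K -> closure (e @` K) `<=` range e -> compact K.
Proof.
move=> clK Ksub F FF FK.
have cK : compact (closure (e @` K)).
  by apply: subclosed_compact (@stone_cech_compact R X) _ => //;
    exact: closed_closure.
have eFK : F (e @^-1` closure (e @` K)).
  by apply: filterS FK => x Kx; apply: subset_closure; exists x.
have [p [/Ksub[x _ <-] Fx]] := cK _ (fmap_proper_filter e FF) eFK.
have clFx : cluster F x.
  move=> B C FB; rewrite nbhsE => - [] O [oO Ox] OC.
  move: oO; rewrite (stone_cech_embed_open R X_tychonoff) => -[D oD DO].
  have Dex : D (e x) by rewrite -DO in Ox.
  have FeB : F (e @^-1` (e @` B)) by apply: filterS FB => y By; exists y.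
  have [_ [[y By <-] Dy]] := Fx _ D FeB (open_nbhs_nbhs (conj oD Dex)).
  by exists y; split => //; apply: OC; rewrite -DO.
exists x; split=> //; rewrite (closure_id K).1// => B nB.
by have [y [Ky By]] := clFx K B FK nB; exists y.
Qed.

(** * Cozero sets with compact closure *)

Section compact_cozero.
Variables (f : continuousType X R) (g : continuousType bX R).
Hypothesis gE : forall x, g (e x) = f x.
Hypothesis cf : compact (closure (coz f)).

Let closed_K : closed (e @` closure (coz f)).
Proof.
apply: compact_closed; first exact: stone_cech_hausdorff.
exact: compact_stone_cech_embed.
Qed.

(** The remainder of bX contributes nothing: e(cl (coz f)) is compact, hence
    closed in bX, and g vanishes on the dense part of its complement. *)
Lemma coz_extension : coz g = e @` coz f.
Proof.
apply/seteqP; split=> [p gp|_ [x fx <-]]; last by rewrite /coz /= gE.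
have [ngp|[x Kx xp]] : (~` coz g `|` e @` closure (coz f)) p.
- move: p {gp}; apply: closed_dense_sub (@stone_cech_dense R X) _ _.
    by apply: closedU => //; apply: open_closedC; exact: open_coz.
  move=> _ [x _ <-]; have [fx|nfx] := pselect (coz f x).
    by right; exists x => //; exact: subset_closure.
  by left; rewrite /coz /= gE.
- by case: ngp.
- by exists x => //; rewrite /coz /= -gE xp.
Qed.

(** The closure of coz g stays inside the compact set e(cl (coz f)), so it
    acquires no boundary points in the remainder. *)
Lemma frontier_coz_extension : frontier (coz g) `<=` e @` frontier (coz f).
Proof.
rewrite (frontier_open _ (open_coz g)) (frontier_open _ (open_coz f)).
move=> p [clp ncp].
have : closure (e @` closure (coz f)) p.
  move: p clp {ncp}; rewrite coz_extension; apply: closureS.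
  by apply: image_subset; exact: subset_closure.
rewrite -(closure_id _).1// => -[x Kx xp]; exists x => //; split=> //.
by move: ncp; rewrite -xp /coz /= gE.
Qed.

End compact_cozero.

End stone_cech_facts.

Theorem corollary5p4 (R : realType) (X : topologicalType)
  (X_tychonoff : tychonoff_space X)
  (X_rr_good : rr_good R X)
  (X_not_compact : ~ compact [set: X])
  (A : Type) (A_infinite : infinite_set [set: A])
  (U : A -> set X) (f_ : A -> continuousType X R)
  (U_nonempty : forall a, U a !=set0)
  (U_disjoint : forall a b, a <> b -> U a `&` U b = set0)
  (coz_f : forall a, coz (f_ a) = U a)
  (f_01 : forall a x, 0 <= f_ a x <= 1)
  (f_1 : forall a, exists2 k, U a k & f_ a k = 1)
  (hyp_i : forall a b, a <> b -> frontier (U b) `&` U a = set0)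
  (hyp_ii : forall a, compact (closure (U a)))
  (f : X -> R)
  (f_in : forall a x, U a x -> f x = f_ a x)
  (f_out : forall x, ~ (\bigcup_a U a) x -> f x = 0)
  (hyp_iii : continuous f)
  (hyp_iv : ~ compact (f @^-1` [set 1])) :
  [/\ rr_good R (stone_cech R X),
      ~ B_property R (stone_cech R X)
    & ~ locally_connected (stone_cech R X)].
Proof.
pose e := @stone_cech_embed R X.
have [G GE] : exists G : A -> continuousType (stone_cech R X) R,
    forall a x, G a (e x) = f_ a x.
  exists (fun a => sval (cid (stone_cech_extension (f_01 a)))) => a x.
  exact: (svalP (cid (stone_cech_extension (f_01 a)))).
have f01 x : 0 <= f x <= 1.
  have [[a _ Uax]|/f_out ->] := pselect ((\bigcup_a U a) x).
    by rewrite (f_in a).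
  by rewrite lexx ler01.
have [F FE] : exists F : continuousType (stone_cech R X) R,
    forall x, F (e x) = f x.
  exact: (@stone_cech_extension R X (mkcts hyp_iii) f01).
have cozG a : coz (G a) = e @` U a.
  by rewrite -coz_f; apply: coz_extension; rewrite ?coz_f.
have frG a : frontier (coz (G a)) `<=` e @` frontier (U a).
  by rewrite -coz_f; apply: frontier_coz_extension; rewrite ?coz_f.
have oU a : open (U a) by rewrite -coz_f; exact: open_coz.
(* A boundary point of U a lies in no U b: by (i) if b differs from a, and
   because U a is open if b = a.  So f vanishes there. *)
have fr0 a x : frontier (U a) x -> f x = 0.
  move=> frx; apply: f_out => -[b _ Ubx].
  have [ba|ba] := pselect (b = a); last first.
    by have := hyp_i _ _ ba => /seteqP[/(_ x) + _]; apply.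
  by move: frx; rewrite (frontier_open _ (oU a)) -ba => -[].
pose N := [set p | 1 / 2 < F p].
have oN : open N by exact: open_superlevel.
have frN a : N `&` frontier (coz (G a)) = set0.
  apply/seteqP; split=> // p [Np /frG[x frx xp]]; move: Np.
  rewrite /N /= -xp FE (fr0 _ _ frx).
  by rewrite ltNge divr_ge0.
pose K := f @^-1` [set 1].
have clK : closed K.
  by apply: preimage_closed (@closed_eq R 1) => x _; exact: hyp_iii.
have [z [clz nz]] : exists z, closure (e @` K) z /\ ~ range e z.
  apply: contrapT => nex; apply: hyp_iv.
  have Ke : closure (e @` K) `<=` range e.
    by move=> z clz; apply: contrapT => nz; apply: nex; exists z.
  exact: (compact_of_closure_embed X_tychonoff K clK Ke).
have nzG a : ~ coz (G a) z by rewrite cozG => -[x _ xz]; apply: nz; exists x.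
have Fz : F z = 1.
  have clF1 : closed (F @^-1` [set 1]).
    by apply: preimage_closed (@closed_eq R 1) => p _; exact: cts_fun.
  by apply: clF1; apply: closureS clz => _ [x Kx <-]; rewrite /= FE.
have nNz : nbhs z N.
  by apply: open_nbhs_nbhs; split=> //; rewrite /N /= Fz; lra.
have KU : e @` K `<=` \bigcup_a coz (G a).
  move=> _ [x Kx <-]; have [[a _ Uax]|/f_out fx0] :=
    pselect ((\bigcup_a U a) x).
    by exists a => //; rewrite cozG; exists x.
  by move: Kx; rewrite /K /= fx0 => /esym/eqP; rewrite oner_eq0.
split; first exact: rr_good_stone_cech.
- move=> /(_ A (fun a => coz (G a))) /(_ (fun a => ex_intro _ (G a) erefl)).
  have G0 a : coz (G a) !=set0.
    by rewrite cozG; have [x Ux] := U_nonempty a; exists (e x), x.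
  have Gfr a b : a <> b -> frontier (coz (G a)) `&` coz (G b) = set0.
    move=> ab; apply/seteqP; split=> // _ [/frG[x frx <-]].
    rewrite /coz /= GE => fbx.
    have Ubx : U b x by rewrite -coz_f.
    by have := hyp_i _ _ (nesym ab) => /seteqP[/(_ x) + _]; apply.
  have frz : frontier (\bigcup_a coz (G a)) z.
    split; first by apply: closureS clz; exact: KU.
    by apply: subset_closure => -[a _]; exact: nzG.
  move=> /(_ G0 Gfr z N frz nNz)[b].
  by rewrite frN => -[].
- move=> /(_ z N nNz)[V [oV Vz cV VN]].
  have [q [/KU[a _ Gaq] Vq]] := clz V (open_nbhs_nbhs (conj oV Vz)).
  (* N misses the frontier of coz (G a), so this cozero set is clopen in V. *)
  have VGa : V `&` coz (G a) = V `&` closure (coz (G a)).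
    apply/seteqP; split=> p [Vp Gp]; split=> //; first exact: subset_closure.
    apply: contrapT => nGp.
    suff : (N `&` frontier (coz (G a))) p by rewrite frN.
    by split; [exact: VN | rewrite (frontier_open _ (open_coz _))].
  have VE : V `&` coz (G a) = V.
    apply: cV; first by exists q.
    - by exists (coz (G a)) => //; exact: open_coz.
    - by exists (closure (coz (G a))) => //; exact: closed_closure.
  by move: Vz; rewrite -VE => -[_]; exact: nzG.
Qed.
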